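(* Let $\mathcal A$ be a direct product of commutative unital indecomposable rings with a structure of a (unital) partial $G$-module given by a transitive unital partial action $\alpha$ of a group $G$. Let $n>0$, $w\in Z^n(G,\mathcal A)$, and let $$w'(x_1,\dots,x_n)=1_{(x_1,\dots,x_n)}\prod_{g\in\Lambda}\theta_g\circ w\circ\tau_n^g(x_1,\dots,x_n),$$ $$\varepsilon(x_1,\dots,x_{n-1})=1_{(x_1,\dots,x_{n-1})}\prod_{g\in\Lambda}\theta_g\left(\prod_{i=0}^{n-1}w\circ\sigma_{n-1,i}^g(x_1,\dots,x_{n-1})^{(-1)^i}\right).$$ Then $w=\delta^{n-1}\varepsilon\cdot w'$. In particular, $w'\in Z^n(G,\mathcal A)$.
   Context: A partial action $\alpha$ of a group $G$ (identity $1$) on a ring $\mathcal A$ is a collection of two-sided ideals $\mathcal D_g\subseteq\mathcal A$ and ring isomorphisms $\alpha_g:\mathcal D_{g^{-1}}\to\mathcal D_g$ ($g\in G$) such that (i) $\mathcal D_1=\mathcal A$, $\alpha_1=\mathrm{id}$; (ii) $\alpha_g(\mathcal D_{g^{-1}}\cap\mathcal D_h)=\mathcal D_g\cap\mathcal D_{gh}$; (iii) $\alpha_g(\alpha_h(a))=\alpha_{gh}(a)$ for $a\in\mathcal D_{h^{-1}}\cap\mathcal D_{h^{-1}g^{-1}}$. It is unital if every $\mathcal D_g=1_g\mathcal A$ for an idempotent $1_g$ central in $\mathcal A$. Partial cohomology ($\mathcal A$ commutative, $\alpha$ unital). For $n\ge1$ put $1_{(x_1,\dots,x_n)}=1_{x_1}1_{x_1x_2}\cdots1_{x_1\cdots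 x_n}$ and $\mathcal D_{(x_1,\dots,x_n)}=1_{(x_1,\dots,x_n)}\mathcal A$; for $n=0$ this idempotent is $1_{\mathcal A}$. $C^n(G,\mathcal A)$ is the abelian group (pointwise multiplication) of functions $f:G^n\to\mathcal A$ with $f(x_1,\dots,x_n)$ invertible in the ideal $\mathcal D_{(x_1,\dots,x_n)}$ (whose identity is $1_{(x_1,\dots,x_n)}$); inverses of values of $f$ are taken in these ideals. $C^0(G,\mathcal A)=\mathcal U(\mathcal A)$, the unit group. For $n\ge1$, $(\delta^nf)(x_1,\dots,x_{n+1})=\alpha_{x_1}(1_{x_1^{-1}}f(x_2,\dots,x_{n+1}))\prod_{i=1}^nf(x_1,\dots,x_ix_{i+1},\dots,x_{n+1})^{(-1)^i}\cdot f(x_1,\dots,x_n)^{(-1)^{n+1}}$, and $(\delta^0a)(x)=\alpha_x(1_{x^{-1}}a)a^{-1}$. $Z^n(G,\mathcal A)=\ker\delta^n$. Set-up. $\mathcal A=\prod_{\lambda\in\Lambda}\mathcal A_\lambda$, where each $\mathcal A_\lambda$ is an indecomposable (nonzero, only trivial central idempotents) unital ring, identified with the ideal of $\mathcal A$ generated by the idempotent $1_{\mathcal A_\lambda}$; $\mathrm{pr}_\lambda(a)=1_{\mathcal A_\lambda}a$. For $a_\lambda\in\mathcal A_\lambda$, $\prod_{\lambda\in\Lambda}a_\lambda$ denotes the element $a\in\mathcal A$ with $\mathrm{pr}_\lambda(a)=a_\lambda$ for all $\lambda$. Transitivity of $\alpha$: for all $\lambda',\lambda''\in\Lambda$ there is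 $x\in G$ with $\mathcal A_{\lambda'}\subseteq\mathcal D_{x^{-1}}$ and $\alpha_x(\mathcal A_{\lambda'})=\mathcal A_{\lambda''}$. Fix $\lambda_0\in\Lambda$, let $H=\{x\in G\mid\mathcal A_{\lambda_0}\subseteq\mathcal D_{x^{-1}},\ \alpha_x(\mathcal A_{\lambda_0})=\mathcal A_{\lambda_0}\}$ (a subgroup), and let $\Lambda'\ni1$ be a left transversal of $H$ in $G$. Identify $\Lambda$ with a subset of $\Lambda'$: $\lambda$ corresponds to the unique $g\in\Lambda'$ with $\mathcal A_{\lambda_0}\subseteq\mathcal D_{g^{-1}}$ and $\alpha_g(\mathcal A_{\lambda_0})=\mathcal A_\lambda$; so $\lambda_0=1$ and $\mathcal A_g=\alpha_g(\mathcal A_1)$ for $g\in\Lambda$. For $x\in G$, $\overline x$ is the element of $\Lambda'$ with $x\in\overline xH$, and $\eta(x)=x^{-1}\overline x\in H$. For $g\in\Lambda$ the ring homomorphism $\theta_g:\mathcal A\to\mathcal A_g$ is $\theta_g(a)=\alpha_g(\mathrm{pr}_1(a))$. For $g\in\Lambda'$, $n\ge1$: $\eta_n^g(x_1,\dots,x_n)=\eta(x_n^{-1}\,\overline{x_{n-1}^{-1}\cdots x_1^{-1}g})$ (so $\eta_1^g(x)=\eta(x^{-1}g)$); $\tau_n^g(x_1,\dots,x_n)=(\eta_1^g(x_1),\eta_2^g(x_1,x_2),\dots,\eta_n^g(x_1,\dots,x_n))\in H^n$; and $\sigma_{n,i}^g:G^n\to G^{n+1}$ ($0\le i\le n$) is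 given by $\sigma_{n,0}^g(x_1,\dots,x_n)=(g^{-1},x_1,\dots,x_n)$, $\sigma_{n,i}^g(x_1,\dots,x_n)=(\tau_i^g(x_1,\dots,x_i),(\overline{x_i^{-1}\cdots x_1^{-1}g})^{-1},x_{i+1},\dots,x_n)$ for $0<i<n$, $\sigma_{n,n}^g(x_1,\dots,x_n)=(\tau_n^g(x_1,\dots,x_n),(\overline{x_n^{-1}\cdots x_1^{-1}g})^{-1})$; also $\sigma_{0,0}^g=g^{-1}$. *)

(* Defs.v *)
From HB Require Import structures.
From mathcomp Require Import all_boot all_algebra.
From mathcomp Require Import boolp classical_sets functions.

Set Implicit Arguments.
Unset Strict Implicit.
Unset Printing Implicit Defensive.

Import GRing.Theory.

Local Open Scope classical_set_scope.
Local Open Scope ring_scope.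

Definition two_sided_ideal (A : pzRingType) (I : set A) : Prop :=
  [/\ I 0, forall a b, I a -> I b -> I (a - b) &
      forall r a, I a -> I (r * a) /\ I (a * r)].

(* An isomorphism of (possibly non-unital) rings from the ideal I onto J; the
   values of f outside I are irrelevant. *)
Definition ring_iso_on (A : pzRingType) (I J : set A) (f : A -> A) : Prop :=
  [/\ set_bij I J f,
      forall a b, I a -> I b -> f (a + b) = f a + f b &
      forall a b, I a -> I b -> f (a * b) = f a * f b].

(* The isomorphism D_(g^-1) -> D_g is represented by a total map on A about
   which nothing is assumed outside D_(g^-1). *)
Record partial_action (G : groupType) (A : pzRingType) := PartialAction {
  pa_dom : G -> set A;
  pa_map :> G -> A -> A;
  pa_ideal : forall g, two_sided_ideal (pa_dom g);
  pa_iso : forall g, ring_iso_on (pa_dom g^-1%g) (pa_dom g) (pa_map g);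
  pa_dom1 : pa_dom 1%g = setT;
  pa_map1 : forall a, pa_map 1%g a = a;
  pa_image : forall g h,
    pa_map g @` (pa_dom g^-1%g `&` pa_dom h) = pa_dom g `&` pa_dom (g * h)%g;
  pa_comp : forall g h a,
    pa_dom h^-1%g a -> pa_dom (h^-1 * g^-1)%g a ->
    pa_map g (pa_map h a) = pa_map (g * h)%g a
}.

Definition pideal (A : pzRingType) (e : A) : set A := [set e * a | a in setT].

Record unital_partial_action (G : groupType) (A : pzRingType) :=
  UnitalPartialAction {
    upa_action :> partial_action G A;
    pa_one : G -> A;
    pa_one_idem : forall g, pa_one g * pa_one g = pa_one g;
    pa_one_central : forall g a, pa_one g * a = a * pa_one g;
    pa_dom_one : forall g, pa_dom upa_action g = pideal (pa_one g)
  }.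

Definition indecomposable (R : nzRingType) : Prop :=
  forall e : R, e * e = e -> (forall r, e * r = r * e) -> e = 0 \/ e = 1.

Section IdealUnits.
Variable A : comPzRingType.

(* Units and inverses in the ideal eA, regarded as a ring with identity e. *)
Definition unit_in (e a : A) : Prop :=
  pideal e a /\ exists b, pideal e b /\ a * b = e.

Definition inv_in (e a : A) : A := xget 0 [set b | pideal e b /\ a * b = e].

End IdealUnits.

Section Cohomology.
Variables (G : groupType) (A : comPzRingType).
Variable alpha : unital_partial_action G A.

(* x_1 ... x_k *)
Definition pprod (x : seq G) (k : nat) : G := (\prod_(y <- take k x) y)%g.

(* The identity 1_(x_1, ..., x_n) of the ideal D_(x_1, ..., x_n). *)
Definition idem n (x : n.-tuple G) : A :=
  \prod_(i < n) pa_one alpha (pprod x i.+1).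

(* For n = 0 a cochain is a function on the one-point type 0.-tuple G, that is
   an element of A. *)
Definition cochain n (f : n.-tuple G -> A) : Prop :=
  forall x, unit_in (idem x) (f x).

(* f ^ ((-1) ^ k) in the group of n-cochains *)
Definition spow n (f : n.-tuple G -> A) (k : nat) : n.-tuple G -> A :=
  fun x => if odd k then inv_in (idem x) (f x) else f x.

Lemma contract_size n (i : 'I_n) (x : n.+1.-tuple G) :
  size (take i x ++ (nth 1 x i * nth 1 x i.+1)%g :: drop i.+2 x) == n.
Proof.
rewrite size_cat /= size_take size_drop size_tuple ltnS (ltnW (ltn_ord i)).
by rewrite subSS addnS -addSn subnKC.
Qed.

(* (x_1, ..., x_(i+1) x_(i+2), ..., x_(n+1)); i is 0-based *)
Definition contract n (i : 'I_n) (x : n.+1.-tuple G) : n.-tuple G :=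
  Tuple (contract_size i x).

Definition delta n (f : n.-tuple G -> A) (x : n.+1.-tuple G) : A :=
  alpha (thead x) (pa_one alpha (thead x)^-1%g * f [tuple of behead x])
  * \prod_(i < n) spow f i.+1 (contract i x)
  * spow f n.+1 [tuple of belast (thead x) (behead x)].

Definition cocycle n (f : n.-tuple G -> A) : Prop :=
  cochain f /\ forall x, delta f x = idem x.

End Cohomology.

Section ProductRing.
Variables (L : Type) (A : L -> comNzRingType).

Definition prod_ring : Type := forall l, A l.

HB.instance Definition _ := Choice.copy prod_ring (forall l, A l).

Implicit Types a b c : prod_ring.

Let padd a b : prod_ring := fun l => a l + b l.
Let pzero : prod_ring := fun=> 0.
Let popp a : prod_ring := fun l => - a l.
Let pmul a b : prod_ring := fun l => a l * b l.
Let pone : prod_ring := fun=> 1.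

Let paddA : associative padd.
Proof. by move=> a b c; apply: functional_extensionality_dep => l; apply: addrA. Qed.
Let paddC : commutative padd.
Proof. by move=> a b; apply: functional_extensionality_dep => l; apply: addrC. Qed.
Let padd0 : left_id pzero padd.
Proof. by move=> a; apply: functional_extensionality_dep => l; apply: add0r. Qed.
Let paddN : left_inverse pzero popp padd.
Proof. by move=> a; apply: functional_extensionality_dep => l; apply: addNr. Qed.

HB.instance Definition _ :=
  GRing.isZmodule.Build prod_ring paddA paddC padd0 paddN.

Let pmulA : associative pmul.
Proof. by move=> a b c; apply: functional_extensionality_dep => l; apply: mulrA. Qed.
Let pmulC : commutative pmul.
Proof. by move=> a b; apply: functional_extensionality_dep => l; apply: mulrC. Qed.
Let pmul1 : left_id pone pmul.
Proof. by move=> a; apply: functional_extensionality_dep => l; apply: mul1r. Qed.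
Let pmulDl : left_distributive pmul padd.
Proof. by move=> a b c; apply: functional_extensionality_dep => l; apply: mulrDl. Qed.

Let pmul1r : right_id pone pmul.
Proof. by move=> a; rewrite pmulC pmul1. Qed.
Let pmulDr : right_distributive pmul padd.
Proof. by move=> a b c; rewrite !(pmulC a) pmulDl. Qed.

HB.instance Definition _ :=
  GRing.Zmodule_isPzRing.Build prod_ring pmulA pmul1 pmul1r pmulDl pmulDr.
HB.instance Definition _ :=
  GRing.PzRing_hasCommutativeMul.Build prod_ring pmulC.

(* The identity of the factor A l, as an element of the product. *)
Definition fone (l : L) : prod_ring := fun m => if `[< m = l >] then 1 else 0.

Definition factor (l : L) : set prod_ring := pideal (fone l).

Definition pr (l : L) (a : prod_ring) : prod_ring := fone l * a.

(* The element whose l-th projection pr l is pr l (a l), for every l. *)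
Definition assemble (a : L -> prod_ring) : prod_ring := fun l => a l l.

End ProductRing.

Section Transversal.
Variables (G : groupType) (L : Type) (A : L -> comNzRingType).
Variable alpha : unital_partial_action G (prod_ring A).

Definition carries (x : G) (l m : L) : Prop :=
  factor l `<=` pa_dom alpha x^-1%g /\
  alpha x @` factor l = factor (A := A) m.

Definition transitive_action : Prop := forall l m, exists x, carries x l m.

Definition stab (l : L) : set G := [set x | carries x l l].

Definition left_coset (g : G) (H : set G) : set G := [set (g * h)%g | h in H].

Definition left_transversal (H T : set G) : Prop :=
  forall x, exists! g, T g /\ left_coset g H x.

Variables (l0 : L) (T : set G).

(* The element of the transversal T attached to the index l; the default value
   1 is never used when the action is transitive and T is a left transversal of
   stab l0. *)
Definition rep (l : L) : G := xget 1%g [set g | T g /\ carries g l0 l].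

Definition theta (l : L) (a : prod_ring A) : prod_ring A :=
  alpha (rep l) (pr l0 a).

Definition bar (x : G) : G :=
  xget 1%g [set g | T g /\ left_coset g (stab l0) x].

Definition eta (x : G) : G := (x^-1 * bar x)%g.

(* The representative of x_i^-1 ... x_1^-1 g; it is g itself when i = 0 and g
   is in T. *)
Definition trail (g : G) (x : seq G) (i : nat) : G := bar ((pprod x i)^-1 * g)%g.

(* eta_n g x k is eta_(k+1)^g (x_1, ..., x_(k+1)). *)
Definition eta_n (g : G) (x : seq G) (k : nat) : G :=
  eta ((nth 1%g x k)^-1 * trail g x k)%g.

Definition tau n (g : G) (x : n.-tuple G) : n.-tuple G :=
  [tuple eta_n g x k | k < n].

Lemma sigma_size n (g : G) (i : 'I_n.+1) (x : n.-tuple G) :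
  size (take i (tau g x) ++ (trail g x i)^-1%g :: drop i x) == n.+1.
Proof.
have le_in : (i <= n)%N by rewrite -ltnS.
by rewrite size_cat /= size_takel ?size_drop !size_tuple ?card_ord // addnS subnKC.
Qed.

Definition sigma n (g : G) (i : 'I_n.+1) (x : n.-tuple G) : n.+1.-tuple G :=
  Tuple (sigma_size g i x).

Definition wprime n (w : n.-tuple G -> prod_ring A) (x : n.-tuple G) :
    prod_ring A :=
  idem alpha x * assemble (fun l => theta l (w (tau (rep l) x))).

Definition epsilon n (w : n.+1.-tuple G -> prod_ring A) (x : n.-tuple G) :
    prod_ring A :=
  idem alpha x *
  assemble (fun l => theta l (\prod_(i < n.+1) spow alpha w i (sigma (rep l) i x))).

End Transversal.

(* Main.v *)
(* Write [v k] for the block carried to the block [l] by [x_1 ... x_k].  On the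
   block [l] everything lives in the action groupoid on blocks, in which
   [rep l : l0 -> l] contracts the connected component to the isotropy group
   of [l0]; [tau] is the resulting retraction of strings and the strings
   [sigma i] triangulate the prism between [x] and [tau x].  Transporting the
   identity [delta w = 1] on each of these simplices along [rep l] and taking
   the alternating product over [i], interior faces cancel, the two ends give
   [w x] and [wprime x], and the walls give [delta epsilon x].  The cocycle
   identity for [wprime] at [x] is the one for [w] at [tau x], transported along
   [rep l].  Indecomposability enters by making every [1_x] equal to 0 or 1
   on each block, and making [x] carry a block into another block as soon as
   the domains allow it. *)
Require Import Defs.
From HB Require Import structures.
From mathcomp Require Import all_boot all_algebra zify.
From mathcomp Require Import boolp classical_sets functions.

Set Implicit Arguments.
Unset Strict Implicit.
Unset Printing Implicit Defensive.

Import GRing.Theory.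

Local Open Scope ring_scope.

(** * The unit group of a commutative ring *)

Section UnitGroup.
Variable R : comPzRingType.

Definition invertible (a : R) := exists b, a * b = 1.

(** The inverse is stored with the unit, so that inversion is a swap of components; by uniqueness of
    inverses the first component decides equality. *)
Record units := Units {
  unit_pair : R * R;
  unit_pairP : unit_pair.1 * unit_pair.2 == 1 }.

HB.instance Definition _ := [isSub for unit_pair].
HB.instance Definition _ := [Choice of units by <:].

Implicit Types u v : units.

Lemma units_mul_subproof u v :
  ((unit_pair u).1 * (unit_pair v).1) * ((unit_pair u).2 * (unit_pair v).2) == 1.
Proof. by rewrite mulrACA (eqP (unit_pairP u)) (eqP (unit_pairP v)) mulr1. Qed.

Lemma units_one_subproof : (1 : R) * 1 == 1.
Proof. by rewrite mulr1. Qed.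

Lemma units_inv_subproof u : (unit_pair u).2 * (unit_pair u).1 == 1.
Proof. by rewrite mulrC (eqP (unit_pairP u)). Qed.

Definition units_mul u v := @Units (_, _) (units_mul_subproof u v).
Definition units_one := @Units (_, _) units_one_subproof.
Definition units_inv u := @Units (_, _) (units_inv_subproof u).

Fact units_mulA : associative units_mul.
Proof. by move=> u v w; apply: val_inj; congr pair; rewrite /= mulrA. Qed.
Fact units_mulC : commutative units_mul.
Proof. by move=> u v; apply: val_inj; congr pair; rewrite /= mulrC. Qed.
Fact units_mul1 : left_id units_one units_mul.
Proof. by move=> [[a b] ab]; apply: val_inj; congr pair; rewrite /= mul1r. Qed.
Fact units_mulV : left_inverse units_one units_inv units_mul.
Proof.
move=> u; apply: val_inj; congr pair; rewrite /= ?(eqP (unit_pairP u)) //.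
by rewrite mulrC (eqP (unit_pairP u)).
Qed.

(* The unit group is written additively so that the exponents (-1)^i become
   integer multiples and alternating products become alternating sums. *)
HB.instance Definition _ :=
  GRing.isZmodule.Build units units_mulA units_mulC units_mul1 units_mulV.

Lemma units_eq u v : (unit_pair u).1 = (unit_pair v).1 -> u = v.
Proof.
case: u v => [[a b] ab] [[c d] cd] /= eq_ac; subst c; apply: val_inj; congr pair.
by rewrite /= -[b]mulr1 -(eqP cd) /= mulrA [b * a]mulrC (eqP ab) mul1r.
Qed.

(** A total logarithm, turning products of invertible elements into sums. Elsewhere it takes the
    default 0, which is the unit 1. *)
Definition un (a : R) : units := xget 0 [set u | (unit_pair u).1 = a]%classic.

Lemma unK a : invertible a -> (unit_pair (un a)).1 = a.
Proof.
case=> b /eqP ab; rewrite /un; case: xgetP => [u _ //|no_u].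
by case: (no_u (@Units (a, b) ab)).
Qed.

Lemma un_inj a b : invertible a -> invertible b -> un a = un b -> a = b.
Proof. by move=> Ua Ub eq_ab; rewrite -(unK Ua) eq_ab unK. Qed.

Lemma invertible1 : invertible 1.
Proof. by exists 1; rewrite mulr1. Qed.

Lemma invertibleM a b : invertible a -> invertible b -> invertible (a * b).
Proof. by move=> [c ac] [d bd]; exists (c * d); rewrite mulrACA ac bd mulr1. Qed.

Lemma invertible_prod n (F : 'I_n -> R) :
  (forall i, invertible (F i)) -> invertible (\prod_i F i).
Proof. by move=> UF; apply: big_ind => //; [apply: invertible1 | apply: invertibleM]. Qed.

Lemma un1 : un 1 = 0.
Proof. by apply: units_eq; rewrite unK //; apply: invertible1. Qed.

Lemma unM a b : invertible a -> invertible b -> un (a * b) = un a + un b.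
Proof.
by move=> Ua Ub; apply: units_eq; rewrite unK /= ?unK //; apply: invertibleM.
Qed.

Lemma un_inv a b : a * b = 1 -> un b = - un a.
Proof.
move=> ab; apply/eqP; rewrite -addr_eq0 addrC -unM ?ab ?un1 //; first by exists b.
by exists a; rewrite mulrC.
Qed.

End UnitGroup.

(* Summing the coboundary identities of the n.+2 simplices of a prism with
   alternating signs: interior faces cancel by the second hypothesis. *)
Lemma prism_sum (M : zmodType) (n : nat) (a c : nat -> M) (b : nat -> nat -> M) :
  (forall i, (i < n.+2)%N ->
     a i + \sum_(0 <= j < n.+1) b i j *~ (-1) ^+ j.+1 + c i *~ (-1) ^+ n.+2 = 0) ->
  (forall j, (j < n.+1)%N -> b j.+1 j = b j j) ->
  a 0%N = \sum_(0 <= i < n.+1) a i.+1 *~ (-1) ^+ i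
          + \sum_(0 <= j < n) (\sum_(0 <= i < n.+1)
              (if (i <= j)%N then b i j.+1 else b i.+1 j) *~ (-1) ^+ i) *~ (-1) ^+ j.+1
          + (\sum_(0 <= i < n.+1) c i *~ (-1) ^+ i) *~ (-1) ^+ n.+1
          + c n.+1.
Proof.
move=> cocyc adj.
have sgnD (x : M) i j : x *~ (-1) ^+ i *~ (-1) ^+ j = x *~ (-1) ^+ (i + j).
  by rewrite -mulrzA exprD.
have sgnS (x : M) i : x *~ (-1) ^+ i.+1 = - (x *~ (-1) ^+ i).
  by rewrite exprS mulN1r mulrNz.
(* Face [j] of simplex [i], with its sign once the identity of simplex [i] is weighted by
   [(-1)^i]. *)
pose f i j := b i j *~ (-1) ^+ (i + j.+1).
(* In column [j] the entries [i = j] and [i = j + 1] cancel by [adj]. The ranges [i < j] and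
   [i > j + 1] survive; shifting [j] in the first and [i] in the second gives the right-hand
   side. *)
have interior : \sum_(0 <= i < n.+2) \sum_(0 <= j < n.+1) f i j
    = \sum_(0 <= j < n) \sum_(0 <= i < n.+1)
        (if (i <= j)%N then f i j.+1 else f i.+1 j).
  rewrite exchange_big_nat /=.
  have split_f j : (j < n.+1)%N -> \sum_(0 <= i < n.+2) f i j
      = \sum_(0 <= i < j) f i j + \sum_(j.+2 <= i < n.+2) f i j.
    move=> lt_jn; rewrite (@big_cat_nat _ _ _ j) //=; last lia.
    congr (_ + _); rewrite big_ltn; last lia.
    rewrite big_ltn ?addrA; last lia.
    by rewrite /f adj // addSn sgnS subrr add0r.
  rewrite (eq_big_nat _ _ (F2 := fun j =>
    \sum_(0 <= i < j) f i j + \sum_(j.+2 <= i < n.+2) f i j)); last first.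
    by move=> j /andP[_ lt_jn]; apply: split_f.
  (* The first range is empty for [j = 0], the second for [j = n]: both sums shorten to [n]
     columns. *)
  rewrite big_split /= big_nat_recl // big_geq // add0r.
  rewrite [X in _ + X]big_nat_recr //= [X in _ + (_ + X)]big_geq // addr0.
  rewrite -big_split /=; apply: eq_big_nat => j /andP[_ lt_jn].
  rewrite [RHS](@big_cat_nat _ _ _ j.+1) //=; last lia.
  rewrite big_add1 /=; congr (_ + _); apply: eq_big_nat => i /andP[ij ij'].
    by rewrite ifT //; lia.
  by rewrite ifF //; lia.
have total : \sum_(0 <= i < n.+2) (a i *~ (-1) ^+ i + \sum_(0 <= j < n.+1) f i j
    + c i *~ (-1) ^+ (i + n)) = 0.
  rewrite big_nat_cond big1 // => i /andP[/andP[_ lt_in] _].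
  have := congr1 (fun x => x *~ (-1) ^+ i) (cocyc i lt_in).
  rewrite mul0rz !mulrzDl => eq0; rewrite -[RHS]eq0; congr (_ + _ + _).
    by rewrite mulrz_suml; apply: eq_bigr => j _; rewrite sgnD addnC.
  by rewrite sgnD addnC !addSn !sgnS opprK.
move: total; rewrite !big_split /= interior big_nat_recl //=.
rewrite [X in _ + X = 0]big_nat_recr //=.
have -> : \sum_(0 <= i < n.+1) a i.+1 *~ (-1) ^+ i.+1
    = - \sum_(0 <= i < n.+1) a i.+1 *~ (-1) ^+ i.
  by rewrite -sumrN; apply: eq_bigr => i _; rewrite sgnS.
have -> : \sum_(0 <= j < n) \sum_(0 <= i < n.+1)
        (if (i <= j)%N then f i j.+1 else f i.+1 j)
    = - \sum_(0 <= j < n) (\sum_(0 <= i < n.+1)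
              (if (i <= j)%N then b i j.+1 else b i.+1 j) *~ (-1) ^+ i) *~ (-1) ^+ j.+1.
  rewrite -sumrN; apply: eq_bigr => j _; rewrite mulrz_suml -sumrN.
  apply: eq_bigr => i _; rewrite sgnD -sgnS /f.
  by case: ifP => _; congr (_ *~ _ ^+ _); lia.
have -> : \sum_(0 <= i < n.+1) c i *~ (-1) ^+ (i + n)
    = - (\sum_(0 <= i < n.+1) c i *~ (-1) ^+ i) *~ (-1) ^+ n.+1.
  rewrite mulNrz mulrz_suml -sumrN; apply: eq_bigr => i _.
  by rewrite sgnD addnS sgnS opprK.
(* The last [c] has the odd exponent [n + 1 + n], hence a minus sign. *)
rewrite expr0 mulr1z addSn -(signr_odd _ (n + n).+1) /= addnn odd_double.
rewrite expr1 mulrNz mulr1z mulNrz -!addrA -!opprD !addrA.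
by move/eqP; rewrite subr_eq0 => /eqP.
Qed.

(** * Strings of group elements, their vertices and faces *)

Section Strings.
Variable G : groupType.

Lemma nth_contract n (j : 'I_n) (x : n.+1.-tuple G) k : (k < n)%N ->
  nth 1%g (contract j x) k =
    if (k < j)%N then nth 1%g x k
    else if k == j then (nth 1 x j * nth 1 x j.+1)%g else nth 1%g x k.+1.
Proof.
move=> kn; rewrite /contract /= nth_cat size_takel; last first.
  by rewrite size_tuple ltnW // ltnW // ltnS.
case: ltnP => [kj|jk]; first by rewrite nth_take.
case: eqVneq => [->|kj]; first by rewrite subnn.
by rewrite -[(k - j)%N]prednK /= ?nth_drop; [congr nth|]; lia.
Qed.

Lemma nth_belast n (x : n.+1.-tuple G) k : (k < n)%N ->
  nth 1%g (belast (thead x) (behead x)) k = nth 1%g x k.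
Proof.
case/tupleP: x => a x kn; rewrite theadE /= [in RHS]lastI nth_rcons.
by rewrite size_belast size_tuple kn.
Qed.

Lemma nth0_thead n (x : n.+1.-tuple G) : thead x = nth 1%g x 0%N.
Proof. by case/tupleP: x. Qed.

Lemma pprodS (x : seq G) k : (k < size x)%N ->
  pprod x k.+1 = (pprod x k * nth 1 x k)%g.
Proof. by move=> kx; rewrite /pprod (take_nth 1%g) // -cats1 big_cat big_seq1. Qed.

Lemma pprod_belast n (x : n.+1.-tuple G) k : (k <= n)%N ->
  pprod (belast (thead x) (behead x)) k = pprod x k.
Proof.
case/tupleP: x => a x kn; rewrite /pprod theadE /= [in RHS]lastI -cats1.
by rewrite takel_cat // size_belast size_tuple.
Qed.

Lemma pprod_contract n (j : 'I_n) (x : n.+1.-tuple G) :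
  pprod (contract j x) n = pprod x n.+1.
Proof.
rewrite /pprod [in LHS]take_oversize ?size_tuple // [in RHS]take_oversize ?size_tuple //.
rewrite -[in RHS](cat_take_drop j x) /= !big_cat big_cons /=.
have jn := ltn_ord j.
rewrite [in RHS](drop_nth 1%g) ?size_tuple; last lia.
rewrite [in RHS](drop_nth 1%g (n := j.+1)) ?size_tuple; last lia.
by rewrite !big_cons !mulgA.
Qed.

(** Shared by paths of blocks, where [R] is [carries alpha], and by homogeneous coordinates, so that
    faces are treated once. Entry [k] is an arrow from vertex [k + 1] to vertex [k]. *)
Definition chain (X : Type) (R : G -> X -> X -> Prop) (v : nat -> X) (x : seq G) :=
  forall k, (k < size x)%N -> R (nth 1%g x k) (v k.+1) (v k).

Lemma chain_behead X (R : G -> X -> X -> Prop) v (x : seq G) :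
  chain R v x -> chain R (v \o succn) (behead x).
Proof.
by move=> vx k; rewrite size_behead nth_behead => kx; apply: vx; lia.
Qed.

Lemma chain_belast X (R : G -> X -> X -> Prop) v n (x : n.+1.-tuple G) :
  chain R v x -> chain R v (belast (thead x) (behead x)).
Proof.
move=> vx k; rewrite size_tuple => kn; rewrite nth_belast //.
by apply: vx; rewrite size_tuple ltnW // ltnS.
Qed.

(** The entries merged by [contract j] meet at vertex [j + 1], exactly the one that [bump j.+1]
    skips. *)
Lemma chain_contract X (R : G -> X -> X -> Prop) v n (j : 'I_n) (x : n.+1.-tuple G) :
  (forall y z l m k, R y m l -> R z k m -> R (y * z)%g k l) ->
  chain R v x -> chain R (v \o bump j.+1) (contract j x).
Proof.
move=> RM vx k; rewrite size_tuple => kn; rewrite nth_contract //=.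
have vxk i : (i < n.+1)%N -> R (nth 1%g x i) (v i.+1) (v i).
  by move=> ?; apply: vx; rewrite size_tuple.
have [kj|jk|->] := ltngtP k j.
- rewrite [bump _ k](_ : _ = k) 1?[bump _ k.+1](_ : _ = k.+1);
    try by rewrite /bump; lia.
  by apply: vxk; lia.
- rewrite [bump _ k](_ : _ = k.+1) 1?[bump _ k.+1](_ : _ = k.+2);
    try by rewrite /bump; lia.
  by apply: vxk; lia.
- rewrite [bump _ j](_ : _ = j :> nat) 1?[bump _ j.+1](_ : _ = j.+2);
    try by rewrite /bump; lia.
  by apply: RM; apply: vxk; have := ltn_ord j; lia.
Qed.

(* Homogeneous coordinates: faces of [x] omit an entry of [q]. *)
Definition realizes := chain (fun y (p q : G) => y = q^-1 * p)%g.

Lemma realizes_pprod (x : seq G) : realizes (pprod x) x.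
Proof. by move=> k kx; rewrite pprodS // mulKg. Qed.

Lemma realizes_contract q n (j : 'I_n) (x : n.+1.-tuple G) :
  realizes q x -> realizes (q \o bump j.+1) (contract j x).
Proof.
by apply: chain_contract => y z l m k -> ->; rewrite mulgA mulgK.
Qed.

(** The face identities for [tau] and [sigma] all reduce through this to comparing vertices. *)
Lemma realizes_eq n (x y : n.-tuple G) p q : realizes p x -> realizes q y ->
  (forall k, (k <= n)%N -> p k = q k) -> x = y.
Proof.
move=> px qy pq; apply: val_inj; apply: (@eq_from_nth _ 1%g); rewrite ?size_tuple //.
by move=> k kn; rewrite px ?qy ?size_tuple // !pq // ltnW.
Qed.

End Strings.

(** * Elementary properties of partial actions *)

Section PartialAction.
Variables (G : groupType) (A : pzRingType) (alpha : partial_action G A).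

Lemma pa_dom_map g a : pa_dom alpha g^-1 a -> pa_dom alpha g (alpha g a).
Proof. by case: (pa_iso alpha g) => -[+ _ _] _ _; apply. Qed.

Lemma pa_dom_mul g a b : pa_dom alpha g a -> pa_dom alpha g (a * b).
Proof. by case: (pa_ideal alpha g) => _ _ /(_ b a) + /[dup] Da => /(_ Da)[]. Qed.

Lemma pa_mapM g a b : pa_dom alpha g^-1 a -> pa_dom alpha g^-1 b ->
  alpha g (a * b) = alpha g a * alpha g b.
Proof. by case: (pa_iso alpha g) => _ _; apply. Qed.

Lemma pa_map0 g : alpha g 0 = 0.
Proof.
have [D0 _ _] := pa_ideal alpha g^-1.
have [_ alphaD _] := pa_iso alpha g.
by apply: (addIr (alpha g 0)); rewrite -alphaD // !add0r.
Qed.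

Lemma pa_mapK g a : pa_dom alpha g^-1 a -> alpha g^-1%g (alpha g a) = a.
Proof.
move=> Da; rewrite pa_comp ?invgK ?mulVg ?mulgV ?pa_map1 //.
by rewrite pa_dom1.
Qed.

Lemma pa_map_surj g b : pa_dom alpha g b ->
  exists2 a, pa_dom alpha g^-1 a & alpha g a = b.
Proof. by case: (pa_iso alpha g) => -[_ _ surj] _ _ /surj[a Da <-]; exists a. Qed.

(** The image axiom for [y^-1] applies to [alpha y a], which lies in the domains of index [y] and
    [x^-1] and is sent back to [a]. *)
Lemma pa_dom_comp x y a : pa_dom alpha y^-1 a -> pa_dom alpha x^-1 (alpha y a) ->
  pa_dom alpha (x * y)^-1 a.
Proof.
move=> Dya Dxya.
have [_ +] : (pa_dom alpha y^-1 `&` pa_dom alpha (y^-1 * x^-1))%classic a.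
  rewrite -pa_image; exists (alpha y a); last exact: pa_mapK.
  by split; rewrite ?invgK //; apply: pa_dom_map.
by rewrite invgM.
Qed.

End PartialAction.

Lemma pa_domP (G : groupType) (A : pzRingType) (alpha : unital_partial_action G A)
  g a : pa_dom alpha g a <-> pa_one alpha g * a = a.
Proof.
rewrite pa_dom_one; split=> [[b _ <-]|<-]; last by exists a.
by rewrite mulrA pa_one_idem.
Qed.

(** * Blocks of the product ring and transport between them *)

Section Blocks.
Variables (G : groupType) (L : Type) (A : L -> comNzRingType).
Variable alpha : unital_partial_action G (prod_ring A).
Implicit Types (l m : L) (a b : prod_ring A).

Lemma prod_ring_eq a b : (forall l, a l = b l) -> a = b.
Proof. exact: functional_extensionality_dep. Qed.

Lemma mul_coord a b l : (a * b) l = a l * b l.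
Proof. by []. Qed.

Lemma foneE l : fone A l l = 1.
Proof. by rewrite /fone; case: asboolP. Qed.

Lemma foneN l m : m <> l -> fone A l m = 0.
Proof. by rewrite /fone; case: asboolP. Qed.

Lemma fone_idem l : fone A l * fone A l = fone A l.
Proof.
apply: prod_ring_eq => m; rewrite mul_coord /fone.
by case: asboolP => _; rewrite ?mulr1 ?mulr0.
Qed.

Lemma fone_mul_ext l a b : a l = b l -> fone A l * a = fone A l * b.
Proof.
move=> ab; apply: prod_ring_eq => m; rewrite !mul_coord.
case: (EM (m = l)) => [->|ml]; first by rewrite ab.
by rewrite foneN // !mul0r.
Qed.

Lemma factorP l a : factor l a <-> fone A l * a = a.
Proof.
split=> [[b _ <-]|<-]; last by exists a.
by rewrite mulrA fone_idem.
Qed.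

(** An isomorphism between blocks matches their identities, and the identities generate the
    blocks. *)
Lemma carriesP x m l : carries alpha x m l <->
  pa_dom alpha x^-1 (fone A m) /\ alpha x (fone A m) = fone A l.
Proof.
split=> [[fD img]|[Dm xm]].
  have fm : factor m (fone A m) by apply/factorP; rewrite fone_idem.
  split; first exact: fD.
  have Fl a : factor m a -> factor l (alpha x a) by move=> Fa; rewrite -img; exists a.
  have : factor l (fone A l) by apply/factorP; rewrite fone_idem.
  rewrite -img => -[b Fb xb]; rewrite -xb.
  have /factorP <- := Fl _ fm; rewrite -xb -pa_mapM; try exact: fD.
  by rewrite mulrC; have /factorP -> := Fb.
have Da a : pa_dom alpha x^-1 (fone A m * a) by apply: pa_dom_mul.
split=> [_ [a _ <-]|]; first exact: Da.
apply/seteqP; split=> [_ [_ [a _ <-] <-]|_ [b _ <-]].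
  apply/factorP; rewrite -xm -pa_mapM // mulrA fone_idem //.
have: pa_dom alpha x (fone A l * b).
  by apply: pa_dom_mul; rewrite -xm; apply: pa_dom_map.
move=> /pa_map_surj[c Dc xc]; exists (fone A m * c); first by exists c.
by rewrite pa_mapM // xm xc mulrA fone_idem.
Qed.

Lemma carries1 l : carries alpha 1%g l l.
Proof. by apply/carriesP; rewrite invg1 pa_dom1 pa_map1. Qed.

Lemma carriesV x m l : carries alpha x m l -> carries alpha x^-1%g l m.
Proof.
move=> /carriesP[Dm xm]; apply/carriesP; rewrite -xm pa_mapK // invgK; split=> //.
exact: pa_dom_map.
Qed.

Lemma carriesM x y l m k :
  carries alpha x m l -> carries alpha y k m -> carries alpha (x * y)%g k l.
Proof.
move=> /carriesP[Dm xm] /carriesP[Dk yk]; apply/carriesP.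
have Dxy : pa_dom alpha (x * y)^-1 (fone A k).
  by apply: pa_dom_comp => //; rewrite yk.
by split; rewrite // -pa_comp -?invgM // yk.
Qed.

(* The isomorphism [A m -> A l] induced by an [x] with [carries alpha x m l],
   precomposed with the projection [A -> A m]. *)
Definition transport x m l a : A l := alpha x (fone A m * a) l.

Lemma transport_ext x m l a b :
  a m = b m -> transport x m l a = transport x m l b.
Proof. by rewrite /transport => /fone_mul_ext ->. Qed.

Lemma transport_1g l a : transport 1%g l l a = a l.
Proof. by rewrite /transport pa_map1 mul_coord foneE mul1r. Qed.

Section Transport.
Variables (x : G) (m l : L).
Hypothesis xml : carries alpha x m l.

Lemma carries_dom a : pa_dom alpha x^-1 (fone A m * a).
Proof. by apply: pa_dom_mul; have /carriesP[] := xml. Qed.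

Lemma transport1 : transport x m l 1 = 1.
Proof. by rewrite /transport mulr1; have /carriesP[_ ->] := xml; rewrite foneE. Qed.

Lemma transportM a b :
  transport x m l (a * b) = transport x m l a * transport x m l b.
Proof.
rewrite /transport -mul_coord -pa_mapM; try exact: carries_dom.
by rewrite mulrACA fone_idem.
Qed.

Lemma transport_coord1 a : a m = 1 -> transport x m l a = 1.
Proof. by move=> am; rewrite -transport1; apply: transport_ext. Qed.

(** Asking for agreement on block [m] only lets [b] be an element known just there, such as a value
    of [wprime] or [epsilon]. *)
Lemma transport_comp y k a b : carries alpha y k m ->
  b m = transport y k m a -> transport x m l b = transport (x * y)%g k l a.
Proof.
move=> ykm bm; rewrite (transport_ext x l bm) /transport.
have /carriesP[Dk yk] := ykm; have Dka : pa_dom alpha y^-1 (fone A k * a).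
  exact: pa_dom_mul.
have myk : fone A m * alpha y (fone A k * a) = alpha y (fone A k * a).
  by rewrite -yk -pa_mapM // mulrA fone_idem.
rewrite myk pa_comp // -invgM; apply: pa_dom_mul.
by have /carriesP[] := carriesM xml ykm.
Qed.

(** Evaluates the leading factor of [delta]: since [fone A l] is the image of [fone A m], block [l]
    sees only the coordinate of [a] at [m]. *)
Lemma alpha_coord a :
  alpha x (pa_one alpha x^-1%g * a) l = transport x m l a.
Proof.
have /carriesP[Dm xm] := xml.
have D1 : pa_dom alpha x^-1 (pa_one alpha x^-1%g * a).
  by apply/pa_domP; rewrite mulrA pa_one_idem.
rewrite -[LHS]mul1r -(foneE l) -mul_coord -xm -pa_mapM //.
by rewrite mulrA [fone A m * _]mulrC; move/pa_domP: Dm => ->.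
Qed.

Lemma pa_one_carries : pa_one alpha x l = 1.
Proof.
have: pa_dom alpha x (fone A l).
  by have /carriesP[] := carriesV xml; rewrite invgK.
by move/pa_domP/(congr1 (fun a => a l)); rewrite mul_coord foneE mulr1.
Qed.

Lemma invertible_transport a : invertible (a m) -> invertible (transport x m l a).
Proof.
case=> c ac; suff [b ab] : exists b, (a * b) m = 1.
  by exists (transport x m l b); rewrite -transportM transport_coord1.
(* The inverse [c] is placed at coordinate [m] and extended by 0; the cast disappears at [m] by
   proof irrelevance. *)
exists (fun i => if pselect (m = i) is left e then ecast z (A z) e c else 0).
by rewrite mul_coord; case: pselect => // e; rewrite (Prop_irrelevance e erefl).
Qed.

End Transport.

(** * Consequences of indecomposability *)

Section Indecomposable.
Hypothesis indecA : forall l, indecomposable (A l).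

Lemma idem_coord a l : a * a = a -> a l = 0 \/ a l = 1.
Proof.
move=> aa; apply: indecA => [|r]; last exact: mulrC.
by rewrite -mul_coord aa.
Qed.

(** The preimage [e] of [fone A l] is a nonzero idempotent, so it is 1 on some block [m]. The image
    of [fone A m] is then a nonzero idempotent below [fone A l], hence equal to it. *)
Lemma pa_one_coord1 x l : pa_one alpha x l = 1 -> exists m, carries alpha x m l.
Proof.
move=> x1; have Dl : pa_dom alpha x (fone A l).
  apply/pa_domP; rewrite mulrC -[RHS]mulr1; exact: fone_mul_ext.
have [e De xe] := pa_map_surj Dl.
have ee : e * e = e.
  by rewrite -(pa_mapK De) -pa_mapM ?invgK ?xe ?fone_idem.
have [m em] : exists m, e m = 1.
  apply: contrapT => no_m; have e0 : e = 0.
    apply: prod_ring_eq => m; have [//|em] := idem_coord m ee.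
    by case: no_m; exists m.
  have := congr1 (fun a : prod_ring A => a l) xe; rewrite foneE e0 pa_map0.
  by move/esym/eqP; rewrite oner_eq0.
have emE : e * fone A m = fone A m.
  by rewrite mulrC -[RHS]mulr1; apply: fone_mul_ext.
have Dm : pa_dom alpha x^-1 (fone A m) by rewrite -emE; apply: pa_dom_mul.
exists m; apply/carriesP; split=> //.
have lxm : fone A l * alpha x (fone A m) = alpha x (fone A m).
  by rewrite -xe -pa_mapM // emE.
have [xm0|xm1] : alpha x (fone A m) l = 0 \/ alpha x (fone A m) l = 1.
- by apply: idem_coord; rewrite -pa_mapM // fone_idem.
- have xm0' : alpha x (fone A m) = 0.
    by rewrite -lxm -[RHS](mulr0 (fone A l)); apply: fone_mul_ext.
  have := congr1 (fun a : prod_ring A => a m) (pa_mapK Dm).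
  by rewrite xm0' pa_map0 foneE => /esym/eqP; rewrite oner_eq0.
- by rewrite -lxm -[RHS]mulr1; apply: fone_mul_ext.
Qed.

End Indecomposable.

(* [is_path v x] holds when [x] is a string of composable arrows
   [v 0 <- v 1 <- ... <- v n] of the groupoid in which [x] goes from [m] to [l]
   whenever [carries alpha x m l]. *)
Definition is_path (v : nat -> L) (x : seq G) := chain (carries alpha) v x.

Lemma path_pprod v (x : seq G) k : is_path v x -> (k <= size x)%N ->
  carries alpha (pprod x k) (v k) (v 0%N).
Proof.
move=> vx; elim: k => [|k IHk] kx.
  by rewrite /pprod take0 big_nil; apply: carries1.
by rewrite pprodS //; apply: carriesM (vx k kx); apply: IHk; apply: ltnW.
Qed.

Lemma idem_path n (x : n.-tuple G) v : is_path v x -> idem alpha x (v 0%N) = 1.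
Proof.
move=> vx; rewrite /idem.
elim/big_ind: _ => // [a b a1 b1|i _]; first by rewrite mul_coord a1 b1 mulr1.
by apply: pa_one_carries (path_pprod vx _); rewrite size_tuple.
Qed.

Lemma idem_idem n (x : n.-tuple G) : idem alpha x * idem alpha x = idem alpha x.
Proof. by rewrite -big_split; apply: eq_bigr => i _; rewrite /= pa_one_idem. Qed.

(** Converse to [idem_path]: on a block either a path is available or every cochain vanishes, and
    identities are checked by this dichotomy. *)
Lemma pathP n (x : n.-tuple G) l : (forall m, indecomposable (A m)) ->
  idem alpha x l <> 0 -> exists2 v, v 0%N = l & is_path v x.
Proof.
move=> indecA xl.
have one_x k : (k < n)%N -> pa_one alpha (pprod x k.+1) l = 1.
  move=> kn; have [x0|//] := idem_coord indecA l (pa_one_idem alpha (pprod x k.+1)).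
  by case: xl; rewrite /idem (bigD1 (Ordinal kn)) //= mul_coord x0 mul0r.
have /choice[v vP] : forall k, exists m, (k < n)%N -> carries alpha (pprod x k.+1) m l.
  move=> k; case: (ltnP k n) => [kn|]; last by exists l.
  by have [m] := pa_one_coord1 indecA (one_x k kn); exists m.
(* [v j] belongs to the prefix of length [j + 1], hence the shift; beyond the string its value is
   arbitrary. *)
exists (fun k => if k is j.+1 then v j else l) => // k; rewrite size_tuple => kn.
have cv : carries alpha (pprod x k) (if k is j.+1 then v j else l) l.
  case: k kn => [|j] kn; first by rewrite /pprod take0 big_nil; apply: carries1.
  by apply: vP; apply: ltnW.
have := carriesM (carriesV cv) (vP k kn).
by rewrite pprodS ?size_tuple // mulKg.
Qed.

Lemma path_contract v n (j : 'I_n) (x : n.+1.-tuple G) :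
  is_path v x -> is_path (v \o bump j.+1) (contract j x).
Proof. by apply: chain_contract => y z l m k; apply: carriesM. Qed.

(** * Cochains evaluated along paths *)

Section Cochains.
Hypothesis indecA : forall l, indecomposable (A l).
Variables (n : nat) (f : n.-tuple G -> prod_ring A).

(** Inverses are chosen block by block; where the idempotent is 0 any choice works. *)
Lemma cochainP : (forall x, idem alpha x * f x = f x) ->
  (forall (x : n.-tuple G) v, is_path v x -> invertible (f x (v 0%N))) -> cochain alpha f.
Proof.
move=> fx Uf x; split; first by exists (f x).
have inv_f l : exists c, idem alpha x l * (f x l * c) = idem alpha x l.
  case: (EM (idem alpha x l = 0)) => [->|/(pathP indecA)[v <- vx]].
    by exists 0; rewrite mul0r.
  by have [c fc] := Uf x v vx; exists c; rewrite fc mulr1.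
pose b : prod_ring A := fun l => projT1 (cid (inv_f l)).
exists (idem alpha x * b); split; first by exists b.
apply: prod_ring_eq => l; rewrite mulrCA !mul_coord.
by rewrite /b; case: cid.
Qed.

Hypothesis cf : cochain alpha f.

Lemma cochain_supp x : idem alpha x * f x = f x.
Proof. by have [[a _ <-] _] := cf x; rewrite mulrA idem_idem. Qed.

Lemma inv_inP x : f x * inv_in (idem alpha x) (f x) = idem alpha x.
Proof.
rewrite /inv_in; case: xgetP => [b _ [_ //]|no_b].
by have [_ [b bP]] := cf x; case: (no_b b).
Qed.

Lemma cochain_invertible (x : n.-tuple G) v : is_path v x -> invertible (f x (v 0%N)).
Proof.
move=> vx; exists (inv_in (idem alpha x) (f x) (v 0%N)).
by rewrite -mul_coord inv_inP idem_path.
Qed.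

Lemma spow_invertible k (x : n.-tuple G) v :
  is_path v x -> invertible (spow alpha f k x (v 0%N)).
Proof.
rewrite /spow; case: odd => vx; last exact: cochain_invertible.
exists (f x (v 0%N)); rewrite mulrC -mul_coord inv_inP; exact: idem_path.
Qed.

End Cochains.

(** * Coboundaries in the additive unit group of a block *)

Definition utransport y m l a : units (A l) := un (transport y m l a).

Lemma utransportM y m l a b : carries alpha y m l ->
  invertible (a m) -> invertible (b m) ->
  utransport y m l (a * b) = utransport y m l a + utransport y m l b.
Proof.
move=> yml Ua Ub; rewrite /utransport transportM // unM //.
all: exact: invertible_transport.
Qed.

Lemma utransport1 y m l a : carries alpha y m l -> a m = 1 -> utransport y m l a = 0.
Proof. by move=> yml am; rewrite /utransport transport_coord1 // un1. Qed.

Lemma prod_coord N (F : 'I_N -> prod_ring A) l : (\prod_i F i) l = \prod_i F i l.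
Proof. by elim/big_ind2: _ => // a c b d <- <-. Qed.

Lemma utransport_prod y m l N (F : 'I_N -> prod_ring A) : carries alpha y m l ->
  (forall i, invertible (F i m)) ->
  utransport y m l (\prod_i F i) = \sum_i utransport y m l (F i).
Proof.
move=> yml UF.
(* Invertibility joins the induction because [un] is additive only on invertible elements. *)
have: utransport y m l (\prod_i F i) = \sum_i utransport y m l (F i)
    /\ invertible ((\prod_i F i) m).
  elim/big_ind2: _ => //.
    by split; [apply: utransport1 | apply: invertible1].
  move=> a u b v [<- Ua] [<- Ub]; split; first exact: utransportM.
  exact: invertibleM.
by case.
Qed.

Lemma utransport_spow n (f : n.-tuple G -> prod_ring A) k (x : n.-tuple G) v y l :
  cochain alpha f -> is_path v x -> carries alpha y (v 0%N) l ->
  utransport y (v 0%N) l (spow alpha f k x)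
    = utransport y (v 0%N) l (f x) *~ (-1) ^+ k.
Proof.
move=> cf vx yl; rewrite /spow -signr_odd; case: odd => //=.
rewrite expr1 mulrNz; apply: un_inv; rewrite -transportM // inv_inP //.
by apply: transport_coord1 => //; apply: idem_path.
Qed.

Lemma delta_head_invertible n (f : n.-tuple G -> prod_ring A) (x : n.+1.-tuple G) v :
  cochain alpha f -> is_path v x ->
  invertible (alpha (thead x)
    (pa_one alpha (thead x)^-1%g * f [tuple of behead x]) (v 0%N)).
Proof.
move=> cf vx; have x0 : carries alpha (thead x) (v 1%N) (v 0%N).
  by rewrite nth0_thead; apply: vx; rewrite size_tuple.
rewrite (alpha_coord x0); apply: invertible_transport => //.
exact: (@cochain_invertible _ _ cf [tuple of behead x] _ (chain_behead vx)).
Qed.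

Lemma delta_tail_invertible n (f : n.-tuple G -> prod_ring A) (x : n.+1.-tuple G) v :
  cochain alpha f -> is_path v x ->
  invertible (spow alpha f n.+1 [tuple of belast (thead x) (behead x)] (v 0%N)).
Proof.
move=> cf vx.
exact: (@spow_invertible _ _ cf _ [tuple of belast (thead x) (behead x)] _
  (chain_belast vx)).
Qed.

Lemma delta_mid_invertible n (f : n.-tuple G -> prod_ring A) (x : n.+1.-tuple G) v
    (j : 'I_n) :
  cochain alpha f -> is_path v x ->
  invertible (spow alpha f j.+1 (contract j x) (v 0%N)).
Proof. by move=> cf vx; apply: (@spow_invertible _ _ cf _ _ _ (path_contract vx)). Qed.

Lemma delta_invertible n (f : n.-tuple G -> prod_ring A) (x : n.+1.-tuple G) v :
  cochain alpha f -> is_path v x -> invertible (delta alpha f x (v 0%N)).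
Proof.
move=> cf vx; rewrite /delta !mul_coord prod_coord.
apply: invertibleM; last exact: delta_tail_invertible.
apply: invertibleM; first exact: delta_head_invertible.
by apply: invertible_prod => j; apply: delta_mid_invertible.
Qed.

(** The additive coboundary formula. The first face starts at [v 1], so its transporter absorbs the
    first entry of [x]. *)
Lemma utransport_delta n (f : n.-tuple G -> prod_ring A) (x : n.+1.-tuple G) v y l :
  cochain alpha f -> is_path v x -> carries alpha y (v 0%N) l ->
  utransport y (v 0%N) l (delta alpha f x)
    = utransport (y * nth 1 x 0)%g (v 1%N) l (f [tuple of behead x])
      + \sum_(j < n) utransport y (v 0%N) l (f (contract j x)) *~ (-1) ^+ j.+1
      + utransport y (v 0%N) l (f [tuple of belast (thead x) (behead x)])
          *~ (-1) ^+ n.+1.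
Proof.
move=> cf vx yl; have x0 : carries alpha (thead x) (v 1%N) (v 0%N).
  by rewrite nth0_thead; apply: vx; rewrite size_tuple.
have mid := delta_mid_invertible _ cf vx.
have Umid : invertible ((\prod_(j < n) spow alpha f j.+1 (contract j x)) (v 0%N)).
  by rewrite prod_coord; apply: invertible_prod.
have Uhead := delta_head_invertible cf vx.
rewrite /delta !utransportM //; first last.
- exact: delta_tail_invertible.
- exact: invertibleM.
congr (_ + _ + _).
- rewrite /utransport; congr un; rewrite -nth0_thead.
  by apply: transport_comp => //; apply: alpha_coord.
- rewrite utransport_prod //; apply: eq_bigr => j _.
  exact: (@utransport_spow _ _ _ _ _ _ _ cf (path_contract vx)).
- exact: (@utransport_spow _ _ _ [tuple of belast (thead x) (behead x)] _ _ _ cf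
    (chain_belast vx)).
Qed.

Lemma spow_supp n (f : n.-tuple G -> prod_ring A) k x : cochain alpha f ->
  idem alpha x * spow alpha f k x = spow alpha f k x.
Proof.
move=> cf; rewrite /spow; case: odd; last exact: cochain_supp.
(* The default value 0 of [inv_in] is also fixed by the idempotent. *)
rewrite /inv_in; case: xgetP => [b _ [[a _ <-] _]|_]; last by rewrite mulr0.
by rewrite mulrA idem_idem.
Qed.

Lemma pa_one_idemr n (x : n.-tuple G) (k : 'I_n) :
  pa_one alpha (pprod x k.+1) * idem alpha x = idem alpha x.
Proof. by rewrite /idem (bigD1 k) //= mulrA pa_one_idem. Qed.

(** The last face absorbs the idempotents of all proper prefixes. The idempotent of the full product
    is absorbed by the last contraction, which exists since [f] has positive degree. *)
Lemma delta_supp n (f : n.+1.-tuple G -> prod_ring A) (x : n.+2.-tuple G) :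
  cochain alpha f -> idem alpha x * delta alpha f x = delta alpha f x.
Proof.
move=> cf; rewrite {1}/idem; elim/big_ind: _ => [||k _]; first by rewrite mul1r.
  by move=> a b a1 b1; rewrite -mulrA b1.
rewrite /delta; have [kn|nk] := ltnP k n.+1.
  rewrite mulrCA; congr (_ * _); rewrite -(spow_supp _ _ cf) mulrA.
  rewrite -pprod_belast ?ltnS //.
  by rewrite (pa_one_idemr [tuple of belast (thead x) (behead x)] (Ordinal kn)).
rewrite (bigD1 ord_max) //=; set S := spow _ _ _ (contract ord_max x).
suff oneS : pa_one alpha (pprod x k.+1) * S = S.
  by rewrite [LHS]mulrA [_ * (_ * (S * _))]mulrCA [_ * (S * _)]mulrA oneS.
have -> : nat_of_ord k = n.+1 by have := ltn_ord k; lia.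
rewrite -(pprod_contract ord_max) /S -(spow_supp _ _ cf) mulrA.
by rewrite (pa_one_idemr _ ord_max).
Qed.

(** * Retraction to the stabilizer of the base block *)

Section Retraction.
Variables (l0 : L) (T : set G).
Hypotheses (transA : transitive_action alpha)
  (transvT : left_transversal (stab alpha l0) T).

Local Notation rep := (rep alpha l0 T).

(** An arrow from [l0] to [l] exists by transitivity, and its coset representative differs from it
    by a stabilizer element. *)
Lemma rep_spec l : T (rep l) /\ carries alpha (rep l) l0 l.
Proof.
apply: (@xgetPex _ 1%g [set g | T g /\ carries alpha g l0 l]%classic).
have [x xl] := transA l0 l; have [g [[Tg [h Hh gh]] _]] := transvT x.
exists g; split=> //; have -> : g = (x * h^-1)%g by rewrite -gh mulgK.
exact: carriesM xl (carriesV Hh).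
Qed.

Lemma rep_carries l : carries alpha (rep l) l0 l.
Proof. by have [] := rep_spec l. Qed.

Lemma rep_uniq g l : T g -> carries alpha g l0 l -> g = rep l.
Proof.
move=> Tg gl; have [Tr rl] := rep_spec l; have [r [_ uniq_r]] := transvT g.
rewrite -(uniq_r g) ?(uniq_r (rep l)) //; split=> //.
- by exists ((rep l)^-1 * g)%g; [apply: carriesM (carriesV rl) gl | rewrite mulVKg].
- by exists 1%g; [apply: carries1 | rewrite mulg1].
Qed.

(** Cosets of the stabilizer correspond to blocks, so [bar] depends only on the target. This turns
    [trail], [eta_n], [tau] and [sigma] into expressions in [rep]. *)
Lemma bar_rep y l : carries alpha y l0 l -> bar alpha l0 T y = rep l.
Proof.
move=> yl; have [g [gP _]] := transvT y.
have [Tb [h Hh bh]] : T (bar alpha l0 T y) /\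
    left_coset (bar alpha l0 T y) (stab alpha l0) y.
  by apply: (@xgetPex _ 1%g
    [set g | T g /\ left_coset g (stab alpha l0) y]%classic); exists g.
apply: rep_uniq => //; have -> : bar alpha l0 T y = (y * h^-1)%g.
  by rewrite -{2}bh mulgK.
exact: carriesM yl (carriesV Hh).
Qed.

Lemma trail_path v (x : seq G) k : is_path v x -> (k <= size x)%N ->
  trail alpha l0 T (rep (v 0%N)) x k = rep (v k).
Proof.
move=> vx kx; apply: bar_rep.
exact: carriesM (carriesV (path_pprod vx kx)) (rep_carries _).
Qed.

(** A loop at [l0]: out along [rep], across [x_(k+1)], and back. *)
Lemma eta_path v (x : seq G) k : is_path v x -> (k < size x)%N ->
  eta_n alpha l0 T (rep (v 0%N)) x k
    = ((rep (v k))^-1 * nth 1 x k * rep (v k.+1))%g.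
Proof.
move=> vx kx; rewrite /eta_n /Defs.eta trail_path //; last exact: ltnW.
rewrite (bar_rep (l := v k.+1)); first by rewrite invgM invgK.
exact: carriesM (carriesV (vx k kx)) (rep_carries _).
Qed.

Lemma nth_tau v n (x : n.-tuple G) k : is_path v x -> (k < n)%N ->
  nth 1%g (tau alpha l0 T (rep (v 0%N)) x) k
    = ((rep (v k))^-1 * nth 1 x k * rep (v k.+1))%g.
Proof.
move=> vx kn; rewrite -[k]/(nat_of_ord (Ordinal kn)) -tnth_nth tnth_mktuple.
by rewrite eta_path ?size_tuple.
Qed.

Lemma nth_sigma v n (x : n.-tuple G) (i : 'I_n.+1) k :
  is_path v x -> (k < n.+1)%N ->
  nth 1%g (sigma alpha l0 T (rep (v 0%N)) i x) k =
    if (k < i)%N then ((rep (v k))^-1 * nth 1 x k * rep (v k.+1))%g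
    else if k == i then (rep (v i))^-1%g else nth 1%g x k.-1.
Proof.
move=> vx kn; have lin : (i <= n)%N by rewrite -ltnS.
rewrite /sigma /= nth_cat size_takel ?size_tuple ?card_ord //.
case: ltnP => [ki|ik].
  by rewrite nth_take // nth_tau //; lia.
case: eqVneq => [->|ki]; first by rewrite subnn /= trail_path ?size_tuple.
by rewrite -[(k - i)%N]prednK /= ?nth_drop; [congr nth|]; lia.
Qed.

Lemma path_tau v n (x : n.-tuple G) : is_path v x ->
  is_path (fun=> l0) (tau alpha l0 T (rep (v 0%N)) x).
Proof.
move=> vx k; rewrite size_tuple => kn; rewrite nth_tau //.
apply: carriesM (rep_carries _); apply: carriesM (carriesV (rep_carries _)) _.
by apply: vx; rewrite size_tuple.
Qed.

Lemma path_sigma v n (x : n.-tuple G) (i : 'I_n.+1) : is_path v x ->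
  is_path (fun k => if (k <= i)%N then l0 else v k.-1)
    (sigma alpha l0 T (rep (v 0%N)) i x).
Proof.
move=> vx k; rewrite size_tuple => kn; rewrite nth_sigma //.
have vxk j : (j < n)%N -> carries alpha (nth 1%g x j) (v j.+1) (v j).
  by move=> ?; apply: vx; rewrite size_tuple.
have [ki|ik|->] := ltngtP k i; last by apply: carriesV; apply: rep_carries.
- apply: carriesM (rep_carries _); apply: carriesM (carriesV (rep_carries _)) _.
  by apply: vxk; have := ltn_ord i; lia.
- by case: k kn ik => // k kn _; apply: vxk.
Qed.

Lemma realizes_tau v q n (x : n.-tuple G) : is_path v x -> realizes q x ->
  realizes (fun k => q k * rep (v k))%g (tau alpha l0 T (rep (v 0%N)) x).
Proof.
move=> vx qx k; rewrite size_tuple => kn; rewrite nth_tau // qx ?size_tuple //.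
by rewrite invgM !mulgA.
Qed.

(** The prism has two copies of each vertex [k]: [q k * rep (v k)] on the [tau] end and [q k] on the
    [x] end. Simplex [i] lists the first copies of [0..i], then the second copies of [i..n]. *)
Lemma realizes_sigma v q n (x : n.-tuple G) (i : 'I_n.+1) :
  is_path v x -> realizes q x ->
  realizes (fun k => if (k <= i)%N then q k * rep (v k) else q k.-1)%g
    (sigma alpha l0 T (rep (v 0%N)) i x).
Proof.
move=> vx qx k; rewrite size_tuple => kn; rewrite nth_sigma //.
have qxk j : (j < n)%N -> nth 1%g x j = ((q j)^-1 * q j.+1)%g.
  by move=> ?; apply: qx; rewrite size_tuple.
have [ki|ik|->] := ltngtP k i; last by rewrite invgM mulgVK.
- by rewrite qxk ?invgM ?mulgA //; have := ltn_ord i; lia.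
- by case: k kn ik => // k kn _; rewrite /= qxk.
Qed.

(** * Faces of [tau] and of the prism simplices *)

Section Faces.
Variables (v : nat -> L) (n : nat) (x : n.+1.-tuple G).
Hypothesis vx : is_path v x.

Local Notation bhd y := [tuple of behead y].
Local Notation blst y := [tuple of belast (thead y) (behead y)].
Local Notation sg := (sigma alpha l0 T).
Local Notation g := (rep (v 0%N)).

Lemma tau_behead : bhd (tau alpha l0 T g x) = tau alpha l0 T (rep (v 1%N)) (bhd x).
Proof.
have qx := realizes_pprod (x := x).
exact: realizes_eq (chain_behead (realizes_tau vx qx))
  (realizes_tau (chain_behead vx) (chain_behead qx)) _.
Qed.

Lemma tau_belast : blst (tau alpha l0 T g x) = tau alpha l0 T g (blst x).
Proof.
have qx := realizes_pprod (x := x).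
exact: realizes_eq (chain_belast (realizes_tau vx qx))
  (realizes_tau (chain_belast vx) (chain_belast qx)) _.
Qed.

Lemma tau_contract (j : 'I_n) :
  contract j (tau alpha l0 T g x) = tau alpha l0 T g (contract j x).
Proof.
have qx := realizes_pprod (x := x).
exact: realizes_eq (realizes_contract (realizes_tau vx qx))
  (realizes_tau (path_contract vx) (realizes_contract qx)) _.
Qed.

Lemma sigma_behead0 : bhd (sg g ord0 x) = x.
Proof.
have qx := realizes_pprod (x := x).
exact: realizes_eq (chain_behead (realizes_sigma vx qx)) qx _.
Qed.

Lemma sigma_beheadS (i : 'I_n.+1) :
  bhd (sg g (lift ord0 i) x) = sg (rep (v 1%N)) i (bhd x).
Proof.
have qx := realizes_pprod (x := x).
apply: (realizes_eq (chain_behead (realizes_sigma vx qx))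
  (realizes_sigma (chain_behead vx) (chain_behead qx))) => k kn /=.
by case: k kn => [|k] kn; rewrite /bump //= !ltnS.
Qed.

Lemma sigma_belast_max : blst (sg g ord_max x) = tau alpha l0 T g x.
Proof.
have qx := realizes_pprod (x := x).
apply: (realizes_eq (chain_belast (realizes_sigma vx qx)) (realizes_tau vx qx)).
by move=> k kn /=; rewrite kn.
Qed.

Lemma sigma_belast (i : 'I_n.+1) :
  blst (sg g (widen_ord (leqnSn _) i) x) = sg g i (blst x).
Proof.
have qx := realizes_pprod (x := x).
exact: realizes_eq (chain_belast (realizes_sigma vx qx))
  (realizes_sigma (chain_belast vx) (chain_belast qx)) _.
Qed.

(** Adjacent simplices share a face: one loses the [tau] copy of vertex [j + 1], the other the [x]
    copy of vertex [j]. *)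
Lemma sigma_contract_adj (j : 'I_n.+1) :
  contract j (sg g (lift ord0 j) x) = contract j (sg g (widen_ord (leqnSn _) j) x).
Proof.
have qx := realizes_pprod (x := x).
apply: (realizes_eq (realizes_contract (realizes_sigma vx qx))
  (realizes_contract (realizes_sigma vx qx))) => k kn /=.
by have [jk|kj] := leqP j.+1 k; [rewrite !ifF | rewrite !ifT] => //; rewrite /bump; lia.
Qed.

(** A wall: the omitted vertex is the [x] copy of [j + 1], and simplex [i] does not contain its
    [tau] copy. *)
Lemma sigma_contract_ge (i : 'I_n.+1) (j : 'I_n) : (i <= j)%N ->
  contract (lift ord0 j) (sg g (widen_ord (leqnSn _) i) x) = sg g i (contract j x).
Proof.
move=> ij; have qx := realizes_pprod (x := x).
apply: (realizes_eq (realizes_contract (realizes_sigma vx qx))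
  (realizes_sigma (path_contract vx) (realizes_contract qx))) => k kn /=.
have [ki|ik] := leqP k i.
  rewrite ifT; last by rewrite /bump; lia.
  by congr (pprod _ _ * rep (v _))%g; rewrite /bump; lia.
rewrite ifF; last by rewrite /bump; lia.
by congr pprod; rewrite /bump; lia.
Qed.

(** The opposite case: the [tau] copy of [j + 1] is omitted, and the [x] copies begin only at
    [i + 1]. *)
Lemma sigma_contract_lt (i : 'I_n.+1) (j : 'I_n) : (j < i)%N ->
  contract (widen_ord (leqnSn _) j) (sg g (lift ord0 i) x) = sg g i (contract j x).
Proof.
move=> ji; have qx := realizes_pprod (x := x).
apply: (realizes_eq (realizes_contract (realizes_sigma vx qx))
  (realizes_sigma (path_contract vx) (realizes_contract qx))) => k kn /=.
have [ki|ik] := leqP k i.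
  by rewrite ifT //; rewrite /bump; lia.
rewrite ifF; last by rewrite /bump; lia.
by congr pprod; rewrite /bump; lia.
Qed.

End Faces.

(** * The cocycle [wprime] and the homotopy [epsilon] *)

Section Homotopy.
Hypothesis indecA : forall l, indecomposable (A l).

Local Notation tau := (tau alpha l0 T).
Local Notation sigma := (sigma alpha l0 T).
Local Notation wprime := (wprime alpha l0 T).
Local Notation epsilon := (epsilon alpha l0 T).

Section Components.
Variables (n : nat) (w : n.+1.-tuple G -> prod_ring A) (v : nat -> L).
Hypothesis cw : cochain alpha w.

Lemma wprime_coord (x : n.+1.-tuple G) : is_path v x ->
  wprime w x (v 0%N)
    = transport (rep (v 0%N)) l0 (v 0%N) (w (tau (rep (v 0%N)) x)).
Proof. by move=> vx; rewrite /Defs.wprime mul_coord idem_path // mul1r. Qed.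

Lemma wprime_invertible (x : n.+1.-tuple G) :
  is_path v x -> invertible (wprime w x (v 0%N)).
Proof.
move=> vx; rewrite wprime_coord //; apply: invertible_transport (rep_carries _) _ _.
exact: (@cochain_invertible _ _ cw _ _ (path_tau vx)).
Qed.

Lemma utransport_wprime (x : n.+1.-tuple G) y l :
  is_path v x -> carries alpha y (v 0%N) l ->
  utransport y (v 0%N) l (wprime w x)
    = utransport (y * rep (v 0%N))%g l0 l (w (tau (rep (v 0%N)) x)).
Proof.
move=> vx yl; rewrite /utransport; congr un.
by apply: transport_comp yl _ _ _ _ (rep_carries _) _; apply: wprime_coord.
Qed.

Lemma sigma_invertible k (x : n.-tuple G) (i : 'I_n.+1) : is_path v x ->
  invertible (spow alpha w k (sigma (rep (v 0%N)) i x) l0).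
Proof. by move=> vx; apply: (@spow_invertible _ _ cw k _ _ (path_sigma vx)). Qed.

Lemma epsilon_coord (x : n.-tuple G) : is_path v x ->
  epsilon w x (v 0%N)
    = transport (rep (v 0%N)) l0 (v 0%N)
        (\prod_(i < n.+1) spow alpha w i (sigma (rep (v 0%N)) i x)).
Proof. by move=> vx; rewrite /Defs.epsilon mul_coord idem_path // mul1r. Qed.

Lemma epsilon_invertible (x : n.-tuple G) :
  is_path v x -> invertible (epsilon w x (v 0%N)).
Proof.
move=> vx; rewrite epsilon_coord //; apply: invertible_transport (rep_carries _) _ _.
by rewrite prod_coord; apply: invertible_prod => i; apply: sigma_invertible.
Qed.

Lemma utransport_epsilon (x : n.-tuple G) y l :
  is_path v x -> carries alpha y (v 0%N) l ->
  utransport y (v 0%N) l (epsilon w x)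
    = \sum_(i < n.+1) utransport (y * rep (v 0%N))%g l0 l
        (w (sigma (rep (v 0%N)) i x)) *~ (-1) ^+ i.
Proof.
move=> vx yl; have yrl := carriesM yl (rep_carries (v 0%N)).
rewrite [LHS](_ : _ = utransport (y * rep (v 0%N))%g l0 l
    (\prod_(i < n.+1) spow alpha w i (sigma (rep (v 0%N)) i x))); last first.
  rewrite /utransport; congr un.
  by apply: transport_comp yl _ _ _ _ (rep_carries _) _; apply: epsilon_coord.
rewrite utransport_prod // => [|i]; last exact: sigma_invertible.
by apply: eq_bigr => i _; apply: (@utransport_spow _ _ _ _ _ _ _ cw (path_sigma vx)).
Qed.

End Components.

Section Cocycle.
Variables (n : nat) (w : n.+1.-tuple G -> prod_ring A).

Lemma cochain_wprime : cochain alpha w -> cochain alpha (wprime w).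
Proof.
move=> cw; apply: cochainP => // [x|x v]; last exact: wprime_invertible.
by rewrite /Defs.wprime mulrA idem_idem.
Qed.

Lemma cochain_epsilon : cochain alpha w -> cochain alpha (epsilon w).
Proof.
move=> cw; apply: cochainP => // [x|x v]; last exact: epsilon_invertible.
by rewrite /Defs.epsilon mulrA idem_idem.
Qed.

Hypothesis zw : cocycle alpha w.
Let cw : cochain alpha w. Proof. by case: zw. Qed.
Let dw x : delta alpha w x = idem alpha x. Proof. by case: zw. Qed.

Lemma cocycle_wprime : cocycle alpha (wprime w).
Proof.
have cw' := cochain_wprime cw; split=> // x.
apply: prod_ring_eq => l.
have [xl|/(pathP indecA)[v <- vx]] := EM (idem alpha x l = 0).
  by rewrite xl -delta_supp // mul_coord xl mul0r.
rewrite idem_path //; apply: un_inj; [exact: delta_invertible|exact: invertible1|].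
have c1 := carries1 (v 0%N).
have x0 : carries alpha (nth 1%g x 0) (v 1%N) (v 0%N) by apply: vx; rewrite size_tuple.
have rl := rep_carries (v 0%N).
rewrite un1 -transport_1g -/(utransport _ _ _ _) utransport_delta //.
rewrite mul1g (@utransport_wprime _ _ (v \o succn) [tuple of behead x] _ _
  (chain_behead vx)) //.
rewrite (@utransport_wprime _ _ v [tuple of belast (thead x) (behead x)] _ _
  (chain_belast vx)) // mul1g.
rewrite (eq_bigr (fun j : 'I_n.+1 => utransport (rep (v 0%N)) l0 (v 0%N)
    (w (contract j (tau (rep (v 0%N)) x))) *~ (-1) ^+ j.+1)); last first.
  move=> j _; rewrite (@utransport_wprime _ _ (v \o bump j.+1) _ _ _
    (path_contract vx)) // mul1g.
  by rewrite tau_contract.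
rewrite -tau_behead // -tau_belast //.
(* The cocycle identity of [w] on the string of loops [tau], transported from [l0] by [rep]. *)
have := @utransport_delta _ _ _ _ _ _ cw (path_tau vx) rl.
rewrite dw utransport1 ?idem_path //; last exact: path_tau.
move=> d_tau; rewrite [RHS]d_tau; congr (utransport _ _ _ _ + _ + _).
(* The first-face transporters agree: [rep (v 0)] times the first loop is [x_1 * rep (v 1)]. *)
by rewrite nth_tau // mulgA mulVKg.
Qed.

Lemma homotopy x : w x = delta alpha (epsilon w) x * wprime w x.
Proof.
apply: prod_ring_eq => l; rewrite mul_coord.
have [xl|/(pathP indecA)[v <- vx]] := EM (idem alpha x l = 0).
  have w'l : wprime w x l = 0 by rewrite /Defs.wprime mul_coord xl mul0r.
  by rewrite w'l mulr0 -(cochain_supp cw) mul_coord xl mul0r.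
have ce := cochain_epsilon cw.
have c1 := carries1 (v 0%N).
have x0 : carries alpha (nth 1%g x 0) (v 1%N) (v 0%N) by apply: vx; rewrite size_tuple.
have rl := rep_carries (v 0%N).
have Ude := delta_invertible ce vx; have Uw' := wprime_invertible cw vx.
apply: un_inj; [exact: cochain_invertible | exact: invertibleM | rewrite unM //].
have unE (a : prod_ring A) : un (a (v 0%N)) = utransport 1%g (v 0%N) (v 0%N) a.
  by rewrite /utransport transport_1g.
rewrite !unE utransport_delta // mul1g utransport_wprime // mul1g.
(* Simplices and faces are indexed by naturals through [inord], to fit [prism_sum]. *)
pose s i := sigma (rep (v 0%N)) (inord i) x.
pose U := utransport (rep (v 0%N)) l0 (v 0%N).
(* Vertex 1 of simplex [i] lies over [l0], except for [i = 0], where it lies over [v 0]. *)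
pose a i := utransport (rep (v 0%N) * nth 1 (s i) 0)%g
  (if (0 < (inord i : 'I_n.+2))%N then l0 else v 0%N)
  (v 0%N) (w [tuple of behead (s i)]).
pose b i j := U (w (contract (inord j) (s i))).
pose c i := U (w [tuple of belast (thead (s i)) (behead (s i))]).
have inord0 : inord 0 = ord0 :> 'I_n.+2 by apply: val_inj; rewrite /= inordK.
have inordS (m : nat) (i : 'I_m) : inord i.+1 = lift ord0 i :> 'I_m.+1.
  by apply: val_inj; rewrite /= inordK // ltnS.
have inordW (m : nat) (i : 'I_m) : inord i = widen_ord (leqnSn _) i :> 'I_m.+1.
  by apply: val_inj; rewrite /= inordK // ltnW // ltnS.
have a0 : a 0%N = utransport 1%g (v 0%N) (v 0%N) (w x).
  by rewrite /a /s inord0 sigma_behead0 // (nth_sigma ord0 vx (ltn0Sn _)) //= mulgV.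
have aS (i : 'I_n.+1) : a i.+1 = utransport (nth 1 x 0 * rep (v 1%N))%g l0
    (v 0%N) (w (sigma (rep (v 1%N)) i [tuple of behead x])).
  by rewrite /a /s inordS sigma_beheadS //=
    (nth_sigma (lift ord0 i) vx (ltn0Sn _)) mulgA mulVKg.
have cE (i : 'I_n.+1) :
    c i = U (w (sigma (rep (v 0%N)) i [tuple of belast (thead x) (behead x)])).
  by rewrite /c /s inordW sigma_belast.
have c_max : c n.+1 = U (w (tau (rep (v 0%N)) x)).
  rewrite /c /s (_ : inord n.+1 = ord_max) ?sigma_belast_max //.
  by apply: val_inj; rewrite /= inordK.
have bE (i : 'I_n.+1) (j : 'I_n) :
    (if (i <= j)%N then b i j.+1 else b i.+1 j)
      = U (w (sigma (rep (v 0%N)) i (contract j x))).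
  case: leqP => ij; rewrite /b /s inordS inordW.
    by rewrite sigma_contract_ge.
  by rewrite sigma_contract_lt.
have b_adj j : (j < n.+1)%N -> b j.+1 j = b j j.
  move=> jn; rewrite /b /s -[j]/(nat_of_ord (Ordinal jn)) inordS inordW inord_val.
  by rewrite sigma_contract_adj.
have cocyc i : (i < n.+2)%N ->
    a i + \sum_(0 <= j < n.+1) b i j *~ (-1) ^+ j.+1 + c i *~ (-1) ^+ n.+2 = 0.
  move=> im; have ps := path_sigma (i := inord i) vx.
  have := @utransport_delta _ _ _ _ _ _ cw ps rl.
  rewrite dw utransport1 ?(idem_path ps) // => d_s; rewrite [RHS]d_s.
  congr (_ + _ + _); rewrite big_mkord; apply: eq_bigr => j _.
  by rewrite /b inord_val.
rewrite -a0 (prism_sum cocyc b_adj) c_max !big_mkord.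
(* The first three terms are the first, middle and last faces of [epsilon] in [delta]; the fourth,
   [wprime], is already matched. *)
congr (_ + _ + _ + _).
- rewrite (@utransport_epsilon _ _ (v \o succn) cw [tuple of behead x] _ _
    (chain_behead vx)) //.
  by apply: eq_bigr => i _; rewrite aS.
- apply: eq_bigr => j _; congr (_ *~ _).
  rewrite (@utransport_epsilon _ _ (v \o bump j.+1) cw _ _ _ (path_contract vx)) // mul1g.
  by rewrite big_mkord; apply: eq_bigr => i _; rewrite bE.
- congr (_ *~ _).
  rewrite (@utransport_epsilon _ _ v cw [tuple of belast (thead x) (behead x)] _ _
    (chain_belast vx)) // mul1g.
  by apply: eq_bigr => i _; rewrite cE.
Qed.

End Cocycle.
End Homotopy.
End Retraction.
End Blocks.

Theorem theorem3p13 (G : groupType) (L : Type) (A : L -> comNzRingType)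
    (alpha : unital_partial_action G (prod_ring A))
    (l0 : L) (T : set G) (n : nat) (w : n.+1.-tuple G -> prod_ring A) :
  (forall l, indecomposable (A l)) ->
  transitive_action alpha ->
  left_transversal (stab alpha l0) T ->
  T 1%g ->
  cocycle alpha w ->
  [/\ cochain alpha (epsilon alpha l0 T w),
      forall x, w x = delta alpha (epsilon alpha l0 T w) x
                      * wprime alpha l0 T w x
    & cocycle alpha (wprime alpha l0 T w)].
Proof.
move=> indecA transA transvT _ zw; split.
- by apply: cochain_epsilon => //; case: zw.
- exact: homotopy.
- exact: cocycle_wprime.
Qed.
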